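(* Let $m\geq 3$, $n\geq1$, $\epsilon\ge 0$, let $H\subseteq S_m$ be a fixing subgroup and let $f:S_m^n\to S_m/H$ be an $H$-social aggregator with $IR(f)\leq\epsilon$, where $$IR(f)=\sum_{i\in[n],\,j\in[m]}\mathbb{E}_{x^{-i},x_i,y_i}\Big(\mathbf 1_{x_i^{-1}(j)=y_i^{-1}(j)}\Big\|\tfrac{1}{|H|}\big(\mathbf n_{f(x^{-i},x_i)^{-1}(j)}-\mathbf n_{f(x^{-i},y_i)^{-1}(j)}\big)\Big\|_2^2\Big)$$ with $x^{-i}\in S_m^{n-1}$, $x_i,y_i\in S_m$ independent and uniform. Then there is a function $h:S_m^n\to S_m/H$ which is either constant or of the form $h(x)=\{x_i\circ y\circ h':h'\in H\}$ for some $i\in[n]$, $y\in S_m$, such that $$\mathbb{E}_{x\in S_m^n}\big\|\bar P(f(x))-\bar P(h(x))\big\|_F^2\leq O_H(\mathrm{poly}(m)\,\epsilon),$$ i.e. this is at most $c_H\,m^{k}\epsilon$ for an absolute constant $k$ and a constant $c_H$ depending only on $H$.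
   Context: $S_m$ is the symmetric group on $[m]$; a ranking $x\in S_m$ uses the convention $x(\text{rank})=\text{name}$. Profiles are $x\in S_m^n$; $(x^{-i},y_i)$ is $x$ with $x_i$ replaced by $y_i$. $\circ$ is ordinary composition. A subgroup $H$ is fixing if there is a partition of $[m]$ into $k\geq2$ nonempty blocks $B_1,\dots,B_k$ with $H=\{h: h(B_l)=B_l\ \forall l\}$. The coset of $y$ is $Hy=\{y\circ h:h\in H\}$; $S_m/H$ is the set of such cosets, and an $H$-social aggregator is a map $S_m^n\to S_m/H$. The $j$-profile of a coset $K$ is the multiset $K^{-1}(j)=\{z^{-1}(j):z\in K\}$; for a multiset $S$ of elements of $[m]$, $\mathbf n_S\in\mathbb R^m$ has $a$-th entry equal to the multiplicity of $a$ in $S$. For $z\in S_m$, $P(z)_{ab}=\mathbf 1_{z(a)=b}$, and for a coset $K$, $\bar P(K)=\frac1{|H|}\sum_{z\in K}P(z)$; $\|\cdot\|_F$ is the Frobenius norm. (This distance equals the one between the encodings $\frac1{|H|}\sum_{z\in K}\rho^1(z)$ with $\rho^1$ the standard $(m-1)$-dimensional orthogonal representation.) *)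

(* Defs.v *)
From HB Require Import structures.
From mathcomp Require Import all_boot all_order all_algebra all_fingroup.
From mathcomp Require Import reals.

Set Implicit Arguments.
Unset Strict Implicit.
Unset Printing Implicit Defensive.

Import Order.TTheory GRing.Theory Num.Theory GroupScope.
Local Open Scope ring_scope.

(* [m] is 'I_m, and a ranking z : 'S_m sends a rank to a name. The product of *)
(* permutations is in diagrammatic order, (s * t)%g i = t (s i), so that      *)
(* x \o y is (y * x)%g and {y \o h : h in H} is the right coset H :* y.       *)

Notation profile m n := {ffun 'I_n -> 'S_m}.

Definition replace_vote (m n : nat) (x : profile m n) (i : 'I_n) (y : 'S_m) :
    profile m n :=
  [ffun l => if l == i then y else x l].

Definition fixing (m : nat) (H : {set 'S_m}) : Prop :=
  exists P : {set {set 'I_m}},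
    [/\ partition P [set: 'I_m], (2 <= #|P|)%N
      & H = [set h : 'S_m | [forall B in P, h @: B == B]]].

Definition coset_space (m : nat) (H : {set 'S_m}) : Type :=
  {K : {set 'S_m} | K \in rcosets H [set: 'S_m]}.

Lemma mem_rcoset_comp (m : nat) (H : {group 'S_m}) (y z : 'S_m) :
  reflect (exists2 h : 'S_m, h \in H & z =1 y \o h) (z \in H :* y).
Proof.
apply: (iffP rcosetP) => -[h Hh zE]; exists h => //.
  by move=> i; rewrite zE permM.
by apply/permP=> i; rewrite permM zE.
Qed.

Definition social_aggregator (m n : nat) (H : {set 'S_m}) : Type :=
  profile m n -> coset_space H.

Definition is_constant (m n : nat) (H : {set 'S_m})
    (h : social_aggregator n H) : Prop :=
  exists K : coset_space H, forall x, h x = K.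

Definition is_dictatorial (m n : nat) (H : {set 'S_m})
    (h : social_aggregator n H) : Prop :=
  exists (i : 'I_n) (y : 'S_m), forall x, val (h x) = H :* (y * x i)%g.

Section RealValued.
Variable R : realType.

(* Expectation under the uniform distribution on T. *)
Definition expect (T : finType) (F : T -> R) : R :=
  (\sum_(t : T) F t) / #|T|%:R.

(* The Frobenius norm, which is the l^2 norm on row vectors. *)
Definition frobenius (p q : nat) (A : 'M[R]_(p, q)) : R :=
  Num.sqrt (\sum_(a < p) \sum_(b < q) A a b ^+ 2).

(* Multisets are sequences up to permutation: only multiplicities are used. *)
Definition jprofile (m : nat) (K : {set 'S_m}) (j : 'I_m) : seq 'I_m :=
  [seq (z^-1)%g j | z : 'S_m in K].

Definition mult_vec (m : nat) (S : seq 'I_m) : 'rV[R]_m :=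
  \row_a (count_mem a S)%:R.

(* Averaging over x^{-i}, x_i, y_i is averaging over pairs (x, y) with x a    *)
(* whole profile.                                                             *)
Definition IR (m n : nat) (H : {set 'S_m}) (f : social_aggregator n H) : R :=
  \sum_(i < n) \sum_(j < m)
    expect (fun xy : profile m n * 'S_m =>
      let: (x, y) := xy in
      ((x i)^-1%g j == y^-1%g j)%:R *
      frobenius (#|H|%:R^-1 *:
        (mult_vec (jprofile (val (f x)) j) -
         mult_vec (jprofile (val (f (replace_vote x i y))) j))) ^+ 2).

(* perm_mx z a b = (z a == b)%:R *)
Definition Pbar (m : nat) (H : {set 'S_m}) (K : coset_space H) : 'M[R]_m :=
  #|H|%:R^-1 *: \sum_(z in val K) perm_mx z.

End RealValued.

(* Main.v *)
(** Send each name j to the block g_j(x) of ranks that the coset f(x) assigns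
    to it; each block has as many names as ranks. By a hybrid argument over the
    voters, g_j is almost unchanged by any renaming of the votes that fixes j.
    If voters swap the names 1 and 2, all g_j with j > 2 are almost unchanged,
    so the multiset {g_1, g_2} is too.

    Swapping 1 and 2 in all votes thus shows that g_1(x) - g_2(swap x), a formal
    difference of labels, is almost constant: either g_1 is almost constant, or
    all g_j are one function of the ranks of j, and then counting makes each
    label of g_1 have a probability away from 0 and 1.

    In the latter case, if some voters swap 1 and 2 and other voters swap 1 and
    3, then the changes of g_1 add up, because the first one is compensated by
    g_2, which the second group cannot affect. As renamings fixing 1 together
    with a single transposition generate everything in boundedly many steps,
    g_1 is almost additive over every partition of the voters in two groups, and
    a sum of two labels is a label only if one of the groups is irrelevant.
    Hence the probabilities that disjoint groups change g_1 have a product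
    O(eps), and the first voter i for which the voters up to i have noticeable
    influence is a dictator: the other voters change g_1 with probability O(eps).
    After the hybrid argument, only union bounds over a number of events that
    depends on m alone are needed, so the constants do not depend on n. *)

Require Import Defs.
From HB Require Import structures.
From mathcomp Require Import all_boot all_order all_algebra all_fingroup.
From mathcomp Require Import reals zify lra.

Set Implicit Arguments.
Unset Strict Implicit.
Unset Printing Implicit Defensive.

Import Order.TTheory GRing.Theory Num.Theory.
Local Open Scope nat_scope.

(** * Statements with a bounded number of exceptions *)

Section Mostly.
Variable T : finType.

(** Exceptions are counted rather than given a probability, so that the combinatorial part stays in
    [nat]. *)
Definition mostly (c : nat) (Q : pred T) : bool := #|[pred x | ~~ Q x]| <= c.

Lemma mostlyW c c' (Q Q' : pred T) :
  mostly c Q -> (forall x, Q x -> Q' x) -> c <= c' -> mostly c' Q'.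
Proof.
move=> h sub; apply: leq_trans; apply: leq_trans h; apply: subset_leq_card.
by apply/subsetP => x; rewrite !inE; apply: contra; apply: sub.
Qed.

Lemma mostlyT c (Q : pred T) : (forall x, Q x) -> mostly c Q.
Proof. by move=> h; rewrite /mostly eq_card0 // => x; rewrite inE h. Qed.

Lemma mostly_count c (Q Q' : pred T) :
  mostly c (fun x => Q x == Q' x) -> #|Q| <= #|Q'| + c.
Proof.
move=> h; apply: leq_trans (leq_add (leqnn _) h); rewrite -cardUI.
apply: leq_trans (leq_addr _ _); apply: subset_leq_card.
by apply/subsetP => x; rewrite !inE /in_mem /= => ->; case: (Q' x).
Qed.

Lemma mostly_and c c' (Q Q' : pred T) :
  mostly c Q -> mostly c' Q' -> mostly (c + c') (fun x => Q x && Q' x).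
Proof.
move=> h h'; apply: leq_trans (leq_add h h').
rewrite -cardUI; apply: leq_trans (leq_addr _ _); apply: subset_leq_card.
by apply/subsetP => x; rewrite !inE negb_and.
Qed.

Lemma mostly_all (I : finType) (c : I -> nat) (Q : I -> pred T) :
  (forall i, mostly (c i) (Q i)) ->
  mostly (\sum_i c i) (fun x => [forall i, Q i x]).
Proof.
move=> h; apply: (@leq_trans (\sum_i #|[pred x | ~~ Q i x]|)); last first.
  by apply: leq_sum => i _; apply: h.
rewrite (eq_bigr (fun i => \sum_(x | ~~ Q i x) 1)); last first.
  by move=> i _; rewrite sum1_card.
rewrite -sum1_card (exchange_big_dep predT) //=.
rewrite [leqRHS](bigID (fun x => [forall i, Q i x])) /=.
apply: leq_trans (leq_addl _ _); apply: leq_sum => x.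
rewrite /= inE => nA; have /forallPn [i nQ] := nA.
by rewrite (bigD1 i).
Qed.

Lemma mostly_comp c (s : T -> T) (Q : pred T) :
  injective s -> mostly c Q -> mostly c (fun x => Q (s x)).
Proof.
move=> s_inj; apply: leq_trans; rewrite -(card_image s_inj).
by apply: subset_leq_card; apply/subsetP => _ /imageP [x + ->]; rewrite !inE.
Qed.

Lemma mostly_ex c (Q : pred T) : mostly c Q -> c < #|T| -> exists x, Q x.
Proof.
move=> h lt_c; case: (pickP Q) => [x Qx|Q0]; first by exists x.
move: (leq_ltn_trans h lt_c); rewrite ltnNge => /negP []; apply: subset_leq_card.
by apply/subsetP => x _; rewrite !inE Q0.
Qed.

End Mostly.

(** * Renaming the names in each vote *)

Section Shift.
Variables m n : nat.
Implicit Types x th : profile m n.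

(* Vote [i] becomes [th i \o x i]: the names are permuted, not the ranks. *)
Definition shift th x : profile m n := [ffun i => x i * th i]%g.

Lemma shift_inj th : injective (shift th).
Proof.
move=> x y /ffunP e; apply/ffunP => i; have := e i; rewrite !ffunE.
exact: mulIg.
Qed.

Lemma shift_inj_l x : injective (shift^~ x).
Proof.
move=> t u /ffunP e; apply/ffunP => i; have := e i; rewrite !ffunE.
exact: mulgI.
Qed.

Lemma mostly_shift th c (Q : pred (profile m n)) :
  mostly c Q -> mostly c (fun x => Q (shift th x)).
Proof. exact/mostly_comp/shift_inj. Qed.

(** For fixed [x], [shift th x] runs once through all profiles as [th] varies, so the number of
    exceptions, averaged over [y], is at most [c]. *)
Lemma mostly_average c (E : rel (profile m n)) :
  (forall th, mostly c (fun x => E x (shift th x))) ->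
  exists y, mostly c (E^~ y).
Proof.
move=> h; pose N := #|{: profile m n}|.
have lt : \sum_(y : profile m n) #|[pred x | ~~ E x y]| <= N * c.
  rewrite (eq_bigr (fun y => \sum_(x | ~~ E x y) 1)); last first.
    by move=> i _; rewrite sum1_card.
  rewrite (exchange_big_dep predT) //=.
  rewrite (eq_bigr (fun x => \sum_(th | ~~ E x (shift th x)) 1)).
    rewrite (exchange_big_dep predT) //= -sum_nat_const.
    by apply: leq_sum => th _; rewrite sum1_card; apply: h.
  move=> x _; rewrite (reindex (fun th => shift th x)) //=.
  exact/onW_bij/injF_bij/shift_inj_l.
case: (pickP (fun y => #|[pred x | ~~ E x y]| <= c)) => [y hy|all0].
  by exists y.
have : N * c.+1 <= N * c.
  apply: leq_trans lt; rewrite -sum_nat_const; apply: leq_sum => y _.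
  by rewrite ltnNge all0.
have : 0 < N by apply/card_gt0P; exists [ffun=> 1%g].
by move=> N0; rewrite leq_pmul2l // ltnn.
Qed.

End Shift.

(** * Factorizations relative to a point stabilizer, and differences of labels *)

Section Stabilizer.
Variable T : finType.
Hypothesis T_gt2 : 2 < #|T|.
Implicit Types (a b c : T) (s : {perm T}).

(** The stabilizer of [a] has two double cosets, according to whether [s] fixes [a]. The last clause
    gives voters with a trivial renaming only trivial factors. *)
Lemma perm_double_coset a b s : a != b ->
  exists p : bool * ({perm T} * {perm T}),
    [/\ s = p.2.1 * (if p.1 then tperm a b else 1) * p.2.2, p.2.1 a = a,
        p.2.2 a = a & s = 1 -> p = (false, (1, 1))]%g.
Proof.
move=> ab; have [sa|sa] := eqVneq (s a) a.
  by exists (false, (s, 1)%g); rewrite /= !mulg1 perm1; split=> // ->.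
exists (true, (s * tperm b (s a) * tperm a b, tperm b (s a)))%g; split => /=.
- by rewrite -(mulgA _ _ (tperm a b)) tperm2 mulg1 -mulgA tperm2 mulg1.
- by rewrite !permM tpermR tpermR.
- by rewrite tpermD // 1?eq_sym.
- by move=> s1; rewrite s1 perm1 eqxx in sa.
Qed.

Lemma third a b : exists c, (c != a) && (c != b).
Proof.
have := T_gt2; rewrite -cardsT => h.
have : 0 < #|[set: T] :\: [set a; b]|.
  rewrite cardsD setTI subn_gt0; apply: leq_ltn_trans h.
  by rewrite cards2; case: (a != b).
by case/card_gt0P => c; rewrite !inE negb_or => /andP [h' _]; exists c.
Qed.

(** All words have exactly two transpositions, so that the voters can perform them
    simultaneously. *)
Lemma perm_word a b s : a != b ->
  exists p : {perm T} * {perm T} * {perm T},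
    [/\ s = p.1.1 * tperm a b * p.1.2 * tperm a b * p.2, p.1.1 a = a,
        p.1.2 a = a & p.2 a = a]%g.
Proof.
move=> ab; have [c /andP [ca cb]] := third a b.
have ac : a != c by rewrite eq_sym.
have [[[] [s1 s2]] [/= -> h1 h2 _]] := perm_double_coset s ac; last first.
  exists (s1, 1, s2)%g; split=> //=; last by rewrite perm1.
  by rewrite !mulg1 -(mulgA _ _ (tperm a b)) tperm2 mulg1.
exists (s1, tperm b c, s2); split=> //=; last first.
  by rewrite tpermD // eq_sym.
congr (_ * _)%g; rewrite -!mulgA; congr (_ * _)%g.
have -> : tperm a c = (tperm b c ^ tperm a b)%g.
  by rewrite tpermJ tpermR tpermD // eq_sym.
by rewrite /conjg tpermV.
Qed.

End Stabilizer.

Section Labels.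
Variable L : eqType.
Implicit Types a b c d p q l : L.

(* [a + b = c + d] in the free abelian group on labels. *)
Definition exch a b c d : bool := (a == c) && (b == d) || (a == d) && (b == c).

(* Encodes [a - b] in the same group. *)
Definition diff a b : option (L * L) := if a == b then None else Some (a, b).

Lemma exch_diff a b c d : exch a b c d -> diff a d = diff c b.
Proof. by rewrite /diff; case/orP=> /andP [/eqP -> /eqP ->]; rewrite ?eqxx. Qed.

Lemma exch_cancel a b c d p q : exch a p b q -> exch c p d q -> exch a d b c.
Proof.
rewrite /exch.
by case/orP=> /andP [/eqP ? /eqP ?]; case/orP=> /andP [/eqP ? /eqP ?]; subst;
  rewrite !eqxx ?orbT.
Qed.

Lemma exch_count a b c d :
  (forall l, (a == l) + (b == l) = (c == l) + (d == l)) -> exch a b c d.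
Proof.
move=> h; rewrite /exch; move: (h a) (h b).
rewrite !eqxx (eq_sym b a) ![c == _]eq_sym ![d == _]eq_sym.
have [->|nab] := eqVneq a b; first by do 2!case: eqP.
have [ac|_] := eqVneq a c; have [ad|_] := eqVneq a d => //=.
  by rewrite -ac eq_sym (negPf nab); case: eqP.
by rewrite -ad (eq_sym b a) (negPf nab); case: (b == c).
Qed.

End Labels.

(** * Labels that depend on one name only, up to few exceptions *)

Section Core.
Variables (m n : nat) (L : eqType).
Variables (g : 'I_m -> profile m n -> L) (r : L -> nat).
Hypothesis m_gt2 : 2 < m.
Hypothesis card_label : forall x l, #|[pred j | g j x == l]| = r l.
Hypothesis r_lt : forall l, r l < m.
Implicit Types (x th : profile m n) (j : 'I_m) (c : nat).

Definition violations j (i : 'I_n) : nat :=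
  #|[pred p : profile m n * 'S_m | ((p.1 i)^-1 j == p.2^-1 j)%g &&
      (g j p.1 != g j (replace_vote p.1 i p.2))]|.

Let D := \sum_j \sum_i violations j i.

(** A renaming that fixes [j] preserves its rank, and distinct [x] give distinct violating pairs. *)
Lemma violation_shift j i (s : 'S_m) th : s j = j ->
  #|[pred x | g j (shift th x) !=
              g j (replace_vote (shift th x) i (shift th x i * s)%g)]|
  <= violations j i.
Proof.
move=> sj; pose e x : profile m n * 'S_m := (shift th x, shift th x i * s)%g.
have e_inj : injective e by move=> x y [/shift_inj].
rewrite -(card_image e_inj); apply: subset_leq_card; apply/subsetP => p.
case/imageP => x; rewrite !inE => ne ->; rewrite /= ne andbT.
by rewrite invMg permM -{2}sj permK.
Qed.

(* Change the votes one at a time. *)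
Lemma mostly_stab j th : (forall i, th i j = j) ->
  mostly D (fun x => g j (shift th x) == g j x).
Proof.
move=> thj.
pose hyb k : profile m n := [ffun i : 'I_n => if i < k then th i else 1%g].
have step (i : 'I_n) : mostly (violations j i)
    (fun x => g j (shift (hyb i) x) == g j (shift (hyb i.+1) x)).
  apply: leq_trans (violation_shift i (hyb i) (thj i)).
  apply: subset_leq_card; apply/subsetP => x; rewrite !inE.
  suff -> : shift (hyb i.+1) x =
    replace_vote (shift (hyb i) x) i (shift (hyb i) x i * th i)%g by [].
  apply/ffunP => k; rewrite !ffunE ltnS leq_eqVlt.
  have [->|/negPf ki] := eqVneq k i; first by rewrite eqxx ltnn mulg1.
  by rewrite -[_ == _ :> nat]/(k == i) ki.
apply: mostlyW (mostly_all step) _ _ => [x /forallP all_eq|]; last first.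
  by rewrite /D (bigD1 j) //= leq_addr.
suff H k : k <= n -> g j (shift (hyb k) x) = g j x.
  rewrite -(H n (leqnn n)); apply/eqP; congr g; apply/ffunP => i.
  by rewrite !ffunE ltn_ord.
elim: k => [_|k IH lt_k]; last by rewrite -(eqP (all_eq (Ordinal lt_k))) IH // ltnW.
by congr g; apply/ffunP => i; rewrite !ffunE mulg1.
Qed.

(** All other names mostly keep their labels. As label [l] is always used [r l] times, the two
    remaining labels form the same multiset. *)
Lemma mostly_exch j1 j2 th : j1 != j2 ->
    (forall i j, j != j1 -> j != j2 -> th i j = j) ->
  mostly (m * D)
    (fun x => exch (g j1 x) (g j2 x) (g j1 (shift th x)) (g j2 (shift th x))).
Proof.
move=> j12 thP.
pose Q j x := [|| j == j1, j == j2 | g j (shift th x) == g j x].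
have QP j : mostly D (Q j).
  rewrite /Q; have [->|j_1] := eqVneq j j1; first exact: mostlyT.
  have [->|j_2] := eqVneq j j2; first exact: mostlyT.
  by apply: mostly_stab => i; apply: thP.
apply: mostlyW (mostly_all QP) _ _ => [x /forallP all_eq|]; last first.
  by rewrite sum_nat_const card_ord.
apply: exch_count => l.
have split_card y : (g j1 y == l) + (g j2 y == l) +
    \sum_(j | (j != j1) && (j != j2)) (g j y == l) = r l.
  rewrite -(card_label y l) -sum1_card [RHS]big_mkcond [RHS](bigD1 j1) //=.
  by rewrite [X in _ = _ + X](bigD1 j2) /= ?addnA // eq_sym.
apply/eqP; rewrite -(eqn_add2r (\sum_(j | (j != j1) && (j != j2)) (g j x == l))).
rewrite split_card -(split_card (shift th x)) eqn_add2l; apply/eqP.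
apply: eq_bigr => j /andP [/negPf n1 /negPf n2].
by move: (all_eq j); rewrite /Q n1 n2 => /eqP ->.
Qed.

Definition swap j1 j2 : profile m n := [ffun=> tperm j1 j2].

Lemma shift_swapK j1 j2 x : shift (swap j1 j2) (shift (swap j1 j2) x) = x.
Proof. by apply/ffunP => i; rewrite !ffunE -mulgA tperm2 mulg1. Qed.

(* With [h x = g j1 x - g j2 (swap x)], a function which is nearly invariant  *)
(* both under renamings of the votes that fix [j1] and under the swap, hence  *)
(* nearly constant.                                                           *)
Lemma swap_diff_const j1 j2 : j1 != j2 ->
  exists v, mostly (2 * (m + 3) * D)
    (fun x => diff (g j1 x) (g j2 (shift (swap j1 j2) x)) == v).
Proof.
move=> j12; pose h x := diff (g j1 x) (g j2 (shift (swap j1 j2) x)).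
have h_stab th : (forall i, th i j1 = j1) ->
    mostly (2 * D) (fun x => h (shift th x) == h x).
  (* Moving [th] past the swap conjugates it into a renaming that fixes [j2]. *)
  move=> thj; pose th' : profile m n := [ffun i => th i ^ tperm j1 j2]%g.
  have th'j i : th' i j2 = j2 by rewrite ffunE -{2}(tpermL j1 j2) permJ thj tpermL.
  have := mostly_and (mostly_stab thj) (mostly_shift (swap j1 j2) (mostly_stab th'j)).
  move/mostlyW; apply; last by move: (D) => d; clear; lia.
  move=> x /andP [/eqP e1 /eqP e2]; rewrite /h e1 -e2; apply/eqP; congr (diff _ (g _ _)).
  apply/ffunP => i; rewrite !ffunE /conjg tpermV -!mulgA.
  by rewrite (mulgA (tperm _ _)) tperm2 mul1g.
have h_swap : mostly (m * D) (fun x => h (shift (swap j1 j2) x) == h x).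
  have swP i j : j != j1 -> j != j2 -> swap j1 j2 i j = j.
    by move=> n1 n2; rewrite ffunE tpermD // eq_sym.
  apply: mostlyW (mostly_exch j12 swP) _ (leqnn _) => x /exch_diff.
  by rewrite /h shift_swapK => ->.
suff [th hth]: exists y, mostly (2 * (m + 3) * D) (fun x => h y == h x).
  by exists (h th); apply: mostlyW hth _ (leqnn _) => x; rewrite eq_sym.
apply: (@mostly_average _ _ _ (fun x y => h y == h x)) => th.
have card_gt2 : 2 < #|'I_m| by rewrite card_ord.
have [p pP] := fin_all_exists (fun i => perm_word card_gt2 (th i) j12).
pose t1 : profile m n := [ffun i => (p i).1.1].
pose t2 : profile m n := [ffun i => (p i).1.2].
pose t3 : profile m n := [ffun i => (p i).2].
have t1P i : t1 i j1 = j1 by rewrite ffunE; case: (pP i).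
have t2P i : t2 i j1 = j1 by rewrite ffunE; case: (pP i).
have t3P i : t3 i j1 = j1 by rewrite ffunE; case: (pP i).
have H1 := h_stab t1 t1P.
have H2 := mostly_shift t1 h_swap.
have H3 := mostly_shift t1 (mostly_shift (swap j1 j2) (h_stab t2 t2P)).
have H4 := mostly_shift t1 (mostly_shift (swap j1 j2) (mostly_shift t2 h_swap)).
have H5 := mostly_shift t1 (mostly_shift (swap j1 j2)
  (mostly_shift t2 (mostly_shift (swap j1 j2) (h_stab t3 t3P)))).
have := mostly_and H1 (mostly_and H2 (mostly_and H3 (mostly_and H4 H5))).
move/mostlyW; apply; last by move: (D) => d; clear; lia.
move=> x /= /and5P [/eqP <- /eqP <- /eqP <- /eqP <- /eqP <-].
apply/eqP; congr h; apply/ffunP => i; rewrite !ffunE.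
by case: (pP i) => -> _ _ _; rewrite !mulgA.
Qed.

(** Two exchanges cost [2 * m * D] and six stabilizer steps [6 * D], both in the result above and in
    the rectangle below. *)
Let C := 2 * (m + 3) * D.
Implicit Types (a b : profile m n).

(** A nonzero formal difference determines its positive label, which is that of [j1]; a zero
    difference means equal labels. *)
Lemma const_or_swap j1 :
  (exists l, mostly C (fun x => g j1 x == l)) \/
  (forall j2, mostly C (fun x => g j1 x == g j2 (shift (swap j1 j2) x))).
Proof.
pose Q j2 := mostly C (fun x => g j1 x == g j2 (shift (swap j1 j2) x)).
have [/forallP allQ|/forallPn [j2 nQ]] := boolP [forall j2, Q j2]; [by right|left].
have j12 : j1 != j2.
  apply: contra nQ => /eqP <-; apply: mostlyT => x; apply/eqP; congr g.
  by apply/ffunP => i; rewrite !ffunE tperm1 mulg1.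
have [[[l l']|] /= vP] := swap_diff_const j12.
  exists l; apply: mostlyW vP _ (leqnn _) => x; rewrite /diff.
  by case: ifP => // _ /eqP [->].
case/negP: nQ; apply: mostlyW vP _ (leqnn _) => x; rewrite /diff.
by case: ifP.
Qed.

(* Up to renamings fixing [j], which [g j] ignores, [a] swaps [j] with [j2] and *)
(* [b] swaps [j] with [j3]. The effect of [a] on [g j] is then the opposite of  *)
(* its effect on [g j2], which does not depend on [b].                          *)
Lemma mostly_rectangle j a b : (forall i, a i = 1%g \/ b i = 1%g) ->
  mostly C (fun x => exch (g j x) (g j (shift b (shift a x)))
                          (g j (shift a x)) (g j (shift b x))).
Proof.
move=> ab1; have card_gt2 : 2 < #|'I_m| by rewrite card_ord.
have [j2 /andP [j2j _]] := third card_gt2 j j.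
have [j3 /andP [j3j j32]] := third card_gt2 j j2.
rewrite eq_sym in j2j; rewrite eq_sym in j3j.
have [p pP] := fin_all_exists (fun i => perm_double_coset (a i) j2j).
have [q qP] := fin_all_exists (fun i => perm_double_coset (b i) j3j).
(* Each voter has a trivial [a i] or [b i], so [s] can apply the left factors of both at once. The
   [w] factors then apply the right factors and undo any left factor not wanted. *)
pose s : profile m n := [ffun i => (p i).2.1 * (q i).2.1]%g.
pose ta : profile m n := [ffun i => if (p i).1 then tperm j j2 else 1]%g.
pose tb : profile m n := [ffun i => if (q i).1 then tperm j j3 else 1]%g.
pose wa : profile m n := [ffun i => (q i).2.1^-1 * (p i).2.2]%g.
pose wb : profile m n := [ffun i => (p i).2.1^-1 * (q i).2.2]%g.
pose wab : profile m n := [ffun i => (p i).2.2 * (q i).2.2]%g.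
have fixV (t : 'S_m) : t j = j -> (t^-1)%g j = j by move=> tj; rewrite -{1}tj permK.
have sj i : s i j = j by rewrite ffunE permM; case: (pP i) (qP i) => _ -> _ _ [].
have waj i : wa i j = j.
  by rewrite ffunE permM; case: (pP i) (qP i) => _ _ h _ [_ /fixV -> _ _].
have wbj i : wb i j = j.
  by rewrite ffunE permM; case: (pP i) (qP i) => _ /fixV -> _ _ [].
have wabj i : wab i j = j.
  by rewrite ffunE permM; case: (pP i) (qP i) => _ _ -> _ [].
have aE x : shift a x = shift wa (shift ta (shift s x)).
  apply/ffunP => i; rewrite !ffunE.
  case: (pP i) (qP i) => pE _ _ a1 [_ _ _ b1]; case: (ab1 i) => [h|/b1 ->] /=.
    by rewrite h (a1 h) /= !mulg1 mul1g mulgK.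
  by rewrite invg1 mul1g mulg1 {1}pE !mulgA.
have bE x : shift b x = shift wb (shift tb (shift s x)).
  apply/ffunP => i; rewrite !ffunE.
  case: (pP i) (qP i) => _ _ _ a1 [qE _ _ b1]; case: (ab1 i) => [/a1 ->|h] /=.
    by rewrite invg1 !mul1g {1}qE !mulgA.
  by rewrite h (b1 h) /= !mulg1 mulgK.
have abE x : shift b (shift a x) = shift wab (shift tb (shift ta (shift s x))).
  apply/ffunP => i; rewrite !ffunE.
  case: (pP i) (qP i) => pE _ _ a1 [qE _ _ b1]; case: (ab1 i) => h.
    by rewrite {1}qE h (a1 h) /= !mul1g !mulg1 !mulgA.
  by rewrite {1}pE h (b1 h) /= !mulg1 !mulgA.
have ta_tb y : shift ta (shift tb y) = shift tb (shift ta y).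
  apply/ffunP => i; rewrite !ffunE -!mulgA; congr (_ * _)%g.
  case: (pP i) (qP i) => _ _ _ a1 [_ _ _ b1].
  by case: (ab1 i) => [/a1 ->|/b1 ->] /=; rewrite ?mulg1 ?mul1g.
have taP i k : k != j -> k != j2 -> ta i k = k.
  by rewrite ffunE => kj kj2; case: ifP; rewrite ?perm1 // tpermD // eq_sym.
have tb2 i : tb i j2 = j2 by rewrite ffunE; case: ifP; rewrite ?perm1 // tpermD.
have E0 := mostly_shift s (mostly_exch j2j taP).
have E1 := mostly_shift s (mostly_shift tb (mostly_exch j2j taP)).
have S0 := mostly_shift s (mostly_stab tb2).
have S1 := mostly_shift s (mostly_shift ta (mostly_stab tb2)).
have R0 := mostly_stab sj.
have R1 := mostly_shift s (mostly_shift ta (mostly_stab waj)).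
have R2 := mostly_shift s (mostly_shift tb (mostly_stab wbj)).
have R3 := mostly_shift s (mostly_shift ta (mostly_shift tb (mostly_stab wabj))).
have R := mostly_and R0 (mostly_and R1 (mostly_and R2 R3)).
have := mostly_and (mostly_and E0 E1) (mostly_and (mostly_and S0 S1) R).
move/mostlyW; apply; last by rewrite /C; move: (D) => d; clear; lia.
move=> x /andP [/andP [e0 e1] /andP [/andP [/eqP s0 /eqP s1]]].
rewrite -abE -aE -bE => /and4P [/eqP <- /eqP -> /eqP -> /eqP ->].
(* Both exchanges involve the same labels of [j2], which cancel. *)
by move: e1; rewrite ta_tb s0 s1; apply: exch_cancel e0.
Qed.

(** * Influence of groups of voters on one label *)

Section Flips.
Variable j : 'I_m.

Definition flip th : pred (profile m n) := fun x => g j x != g j (shift th x).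

Definition flips th : nat := #|flip th|.

(** Whichever way the labels of the rectangle are matched, its two sides in direction [a] both flip
    or both do not. *)
Lemma mostly_flip_shift a b : (forall i, a i = 1%g \/ b i = 1%g) ->
  mostly C (fun x => flip a (shift b x) == flip a x).
Proof.
move=> ab; apply: mostlyW (mostly_rectangle j ab) _ (leqnn _) => x.
have -> : shift b (shift a x) = shift a (shift b x).
  apply/ffunP => i; rewrite !ffunE.
  by case: (ab i) => ->; rewrite !mulg1.
rewrite /flip /exch.
by case/orP => /andP [/eqP -> /eqP ->]; rewrite ?eqxx // eq_sym.
Qed.

Lemma mostly_not_both_flips a b : (forall i, a i = 1%g \/ b i = 1%g) ->
  mostly C (fun x => ~~ (flip a x && flip b x)).
Proof.
move=> ab; apply: mostlyW (mostly_rectangle j ab) _ (leqnn _) => x.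
by rewrite /flip /exch; case/orP => /andP [/eqP -> _]; rewrite eqxx ?andbF.
Qed.

(* For a shift [th] with parts [thA] and [thB], whether [a] flips is unchanged *)
(* by [thB], and whether [b] flips is unchanged by [thA], so that flips by [a] *)
(* at [x] and by [b] at [th x] nearly imply flips by both at [thB x].          *)
Lemma flips_mul (A : {set 'I_n}) a b :
    (forall i, i \notin A -> a i = 1%g) -> (forall i, i \in A -> b i = 1%g) ->
  flips a * flips b <= 3 * C * #|{: profile m n}|.
Proof.
move=> aA bA.
have ab i : a i = 1%g \/ b i = 1%g.
  by have [/bA|/aA] := boolP (i \in A); [right|left].
have -> : flips a * flips b = \sum_th #|[pred x | flip a x && flip b (shift th x)]|.
  rewrite (eq_bigr (fun th => \sum_(x | flip a x && flip b (shift th x)) 1)).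
    rewrite (exchange_big_dep (flip a)) => [|th x _ /andP [] //].
    rewrite -sum_nat_const; apply: eq_bigr => x ax; rewrite /flips -sum1_card.
    rewrite (reindex (fun th => shift th x)); last exact/onW_bij/injF_bij/shift_inj_l.
    have {}ax : flip a x := ax; by apply: eq_bigl => th /=; rewrite ax.
  by move=> th _; rewrite sum1_card.
rewrite mulnC -sum_nat_const; apply: leq_sum => th _.
pose thA : profile m n := [ffun i => if i \in A then th i else 1%g].
pose thB : profile m n := [ffun i => if i \in A then 1%g else th i].
have thE x : shift th x = shift thA (shift thB x).
  by apply/ffunP => i; rewrite !ffunE; case: ifP; rewrite ?mulg1.
have aB i : a i = 1%g \/ thB i = 1%g.
  by rewrite ffunE; case: ifPn => [_|/aA]; [right|left].
have bA' i : b i = 1%g \/ thA i = 1%g.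
  by rewrite ffunE; case: ifPn => [/bA|_]; [left|right].
have := mostly_and (mostly_flip_shift aB) (mostly_and
  (mostly_shift thB (mostly_flip_shift bA')) (mostly_shift thB (mostly_not_both_flips ab))).
rewrite !addnA => H.
have {}H : mostly (3 * C) (fun x => ~~ (flip a x && flip b (shift th x))).
  apply: mostlyW H _ _ => [x|]; last by rewrite !mulSn; lia.
  by case/and3P => /eqP <- /eqP; rewrite -thE => <-.
by apply: leq_trans H; apply: eq_leq; apply: eq_card => x; rewrite !inE negbK.
Qed.

Definition restr (A : {set 'I_n}) th : profile m n :=
  [ffun i => if i \in A then th i else 1%g].

Lemma mostly_flips th : mostly (flips th) (fun x => g j x == g j (shift th x)).
Proof. by apply: eq_leq; apply: eq_card => x; rewrite inE. Qed.

Lemma flips_restr A th : flips th <= flips (restr A th) + flips (restr (~: A) th).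
Proof.
have := mostly_and (mostly_flips (restr A th))
  (mostly_shift (restr A th) (mostly_flips (restr (~: A) th))).
apply: leq_trans; apply: subset_leq_card; apply/subsetP => x.
rewrite !inE; apply: contra => /andP [/eqP -> /eqP ->].
apply/eqP; congr g; apply/ffunP => i; rewrite !ffunE inE.
by case: ifP; rewrite mulg1.
Qed.

Lemma flips_small q (A : {set 'I_n}) a b :
    (forall i, i \notin A -> a i = 1%g) -> (forall i, i \in A -> b i = 1%g) ->
    #|{: profile m n}| <= q * flips a ->
  flips b <= 3 * q * C.
Proof.
move=> aA bA; have N_gt0 : 0 < #|{: profile m n}|.
  by apply/card_gt0P; exists [ffun=> 1%g].
move: (flips_mul aA bA) N_gt0.
move: #|_| (flips a) (flips b) (C) => N fa fb c; clear; nia.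
Qed.

Lemma flips_mulC_small q (A : {set 'I_n}) a b :
    (forall i, i \in A -> a i = 1%g) -> (forall i, i \notin A -> b i = 1%g) ->
    #|{: profile m n}| <= q * flips a ->
  flips b <= 3 * q * C.
Proof.
move=> aA bA; apply: (@flips_small q (~: A)) => i; rewrite inE ?negbK; first exact: aA.
exact: bA.
Qed.

(* The voter [i] is the first one such that the voters up to [i] can flip     *)
(* [g j] with a probability bounded below.                                    *)
Lemma pivotal_voter q th0 : #|{: profile m n}| <= q * flips th0 ->
  exists i, forall b, b i = 1%g -> flips b <= 18 * q * C.
Proof.
set N := #|_| => th0P.
have N_gt0 : 0 < N by apply/card_gt0P; exists [ffun=> 1%g].
pose A t := [set i : 'I_n | i < t].
(* With a third of the influence guaranteed for [th0] as threshold, failure for the voters before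
   [t] leaves the others above the threshold. *)
pose Q t := [exists a : profile m n,
  [forall i, (i \notin A t) ==> (a i == 1%g)] && (N <= 3 * q * flips a)].
have Qn : Q n.
  apply/existsP; exists th0; apply/andP; split; last by lia.
  by apply/forallP => i; rewrite inE ltn_ord.
case: (ex_minnP (ex_intro Q n Qn)) => -[|t] Qt t_min.
  case/existsP: Qt => a /andP [/forallP a1 aN].
  suff a0 : flips a = 0 by rewrite a0 muln0 leqNgt N_gt0 in aN.
  apply/eqP/pred0P => x; apply/negbTE; rewrite negbK; apply/eqP; congr g.
  apply/ffunP => i; rewrite ffunE.
  by move: (a1 i); rewrite inE ltn0 /= => /eqP ->; rewrite mulg1.
have lt_tn : t < n by apply: t_min.
have nQ : ~~ Q t by apply/negP => /t_min; rewrite ltnn.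
exists (Ordinal lt_tn) => b bi.
case/existsP: Qt => a /andP [/forallP a1 aN].
have {}a1 i : i \notin A t.+1 -> a i = 1%g by move/(implyP (a1 i))/eqP.
have after : flips (restr (~: A t) b) <= 9 * q * C.
  have := flips_small a1 _ aN; rewrite mulnA; apply => i; rewrite !inE ffunE !inE.
  rewrite ltnS leq_eqVlt => /orP [/eqP it|->//].
  by rewrite it ltnn /= (_ : i = Ordinal lt_tn) //; apply: val_inj.
have th0_after : N <= 3 * q * flips (restr (~: A t) th0).
  have := flips_restr (A t) th0.
  have : 3 * q * flips (restr (A t) th0) < N.
    rewrite ltnNge; apply: contra nQ => h; apply/existsP; exists (restr (A t) th0).
    rewrite h andbT; apply/forallP => i; apply/implyP => /negPf iA.
    by rewrite ffunE iA.
  move: th0P N_gt0; move: (N) (flips _) (flips _) (flips _) => N' f0 f1 f2; clear; nia.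
have before : flips (restr (A t) b) <= 9 * q * C.
  have := @flips_mulC_small _ (A t) _ (restr (A t) b) _ _ th0_after.
  rewrite mulnA; apply => i h; first by rewrite ffunE inE h.
  by rewrite ffunE (negPf h).
apply: leq_trans (flips_restr (A t) b) _; move: before after.
move: (C) (flips _) (flips _) => c f1 f2; clear; lia.
Qed.

(** The other votes can be replaced by those of a fixed [y], and vote [i] by the standard vote
    [tperm u j], which puts [j] at the same rank [u]. *)
Lemma label_of_rank K i : (forall b, b i = 1%g -> flips b <= K) ->
  exists gam : 'I_m -> L,
    mostly (#|{: 'S_m}| * (K + D)) (fun x => g j x == gam ((x i)^-1 j)%g).
Proof.
move=> hK; pose E x y := g j x == g j (replace_vote y i (tperm ((x i)^-1 j)%g j)).
suff [y hy] : exists y, mostly (#|{: 'S_m}| * (K + D)) (E^~ y).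
  by exists (fun u => g j (replace_vote y i (tperm u j))).
apply: mostly_average => th.
(* The renaming of vote [i] depends on [x], hence a union bound over all [t], vacuous unless [t]
   fixes [j]. *)
have H (t : 'S_m) : mostly (K + D)
    (fun x => (t j == j) ==> (g j x == g j (replace_vote (shift th x) i (x i * t)%g))).
  have [tj|] := boolP (t j == j); last by move=> _; apply: mostlyT.
  pose b : profile m n := [ffun k => if k == i then 1%g else th k].
  pose w : profile m n := [ffun k => if k == i then t else 1%g].
  have wj k : w k j = j by rewrite ffunE; case: ifP; rewrite ?perm1 ?(eqP tj).
  have bi : b i = 1%g by rewrite ffunE eqxx.
  have := mostly_and (mostly_flips b) (mostly_shift b (mostly_stab wj)).
  move/mostlyW; apply; last by rewrite leq_add2r hK.
  move=> x /= /andP [/eqP -> /eqP <-]; apply/eqP; congr g; apply/ffunP => k.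
  by rewrite !ffunE; case: eqP => [->|_]; rewrite ?mulg1.
apply: mostlyW (mostly_all H) _ _ => [x /forallP h|]; last by rewrite sum_nat_const.
rewrite /E; have := h ((x i)^-1 * tperm ((x i)^-1 j) j)%g.
by rewrite permM tpermL eqxx mulKVg.
Qed.

(* All [g k] take the value [l] almost equally often, hence with frequency      *)
(* close to [r l / m], which is neither 0 nor 1.                                *)
Lemma flips_lower_bound :
    (forall j2, mostly C (fun x => g j x == g j2 (shift (swap j j2) x))) ->
    2 * m * C <= #|{: profile m n}| ->
  exists th, #|{: profile m n}| <= 4 * m * m * flips th.
Proof.
move=> swP; set N := #|_| => small.
pose x0 : profile m n := [ffun=> 1%g]; pose l := g j x0.
have N_gt0 : 0 < N by apply/card_gt0P; exists x0.
have r_gt0 : 0 < r l by rewrite -(card_label x0); apply/card_gt0P; exists j; rewrite inE.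
pose p k := #|[pred x | g k x == l]|.
have p_shift k : #|[pred x | g k (shift (swap j k) x) == l]| = p k.
  rewrite /p -(card_image (@shift_inj _ _ (swap j k))); apply: eq_card => x.
  rewrite !inE; apply/imageP/idP => [[y + ->]|h]; first by rewrite inE.
  by exists (shift (swap j k) x); rewrite ?inE shift_swapK.
have p_le k : p j <= p k + C.
  rewrite -(p_shift k) [p j]/p; apply: mostly_count; apply: mostlyW (swP k) _ (leqnn _) => x.
  by rewrite /= => /eqP ->.
have p_ge k : p k <= p j + C.
  rewrite -(p_shift k) [p j]/p; apply: mostly_count; apply: mostlyW (swP k) _ (leqnn _) => x.
  by rewrite /= => /eqP ->.
have sum_p : \sum_k p k = N * r l.
  rewrite /p (eq_bigr (fun k => \sum_(x | g k x == l) 1)).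
    rewrite (exchange_big_dep predT) //= -sum_nat_const; apply: eq_bigr => x _.
    by rewrite sum1_card card_label.
  by move=> k _; rewrite sum1_card.
have const_sum c : \sum_(k < m) c = m * c by rewrite sum_nat_const card_ord.
have lower : N * r l <= m * (p j + C).
  rewrite -sum_p -const_sum; exact: leq_sum.
have upper : m * p j <= N * r l + m * C.
  rewrite -sum_p -(const_sum (p j)) -(const_sum C) -big_split; exact: leq_sum.
(* The sum counts all pairs of profiles with different labels, in particular those where only the
   first has label [l]. *)
have total : p j * #|[pred x | g j x != l]| <= \sum_th flips th.
  have -> : \sum_th flips th = \sum_x #|[pred y | g j x != g j y]|.
    rewrite (eq_bigr (fun th => \sum_(x | flip th x) 1)); last first.
      by move=> th _; rewrite sum1_card.
    rewrite (exchange_big_dep predT) //=; apply: eq_bigr => x _.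
    rewrite -sum1_card [RHS](reindex (fun th => shift th x)) //=.
    exact/onW_bij/injF_bij/shift_inj_l.
  rewrite -sum_nat_const [leqRHS](bigID (fun x => g j x == l)) /=.
  apply: leq_trans (leq_addr _ _); apply: eq_leq; apply: eq_bigr => x /eqP ->.
  by apply: eq_card => y; rewrite !inE eq_sym.
have Np : p j + #|[pred x | g j x != l]| = N.
  by rewrite -[RHS](cardC [pred x | g j x == l]); congr (_ + _); apply: eq_card.
case: (pickP (fun th => N <= 4 * m * m * flips th)) => [th h|none]; first by exists th.
have : 4 * m * m * \sum_th flips th <= N * N.-1.
  rewrite big_distrr /= -sum_nat_const; apply: leq_sum => th _.
  by move: (none th) => /negbT; rewrite -ltnNge; lia.
move: total; have := r_lt l.
move: (\sum_th _) Np lower upper r_gt0 small N_gt0.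
move: (N) (p j) #|_| (r l) (C) => N' p' p'' r' C'; clear -m_gt2.
move=> s Np lower upper r0 small N0 rm total h.
(* By [small], [m * C'] is at most half of [N']; since [0 < r' < m], having and not having label [l]
   both have frequency at least [1 / (2 * m)]. *)
have h1 : N' <= 2 * m * p' by nia.
have h2 : N' <= 2 * m * p'' by nia.
have h3 : N' * N' <= 4 * m * m * (p' * p'').
  by apply: leq_trans (leq_mul h1 h2) _; apply: eq_leq; lia.
have h4 : 4 * m * m * (p' * p'') <= 4 * m * m * s by rewrite leq_mul2l total orbT.
have := leq_trans h3 (leq_trans h4 h); nia.
Qed.

End Flips.

(** * Constant labels or one decisive voter *)

Definition robust_const : nat :=
  m * (2 * (m + 3) + #|{: 'S_m}| * (18 * (4 * m * m) * (2 * (m + 3)) + 1)).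

Lemma robust_dichotomy : 2 * m * C <= #|{: profile m n}| ->
  (exists lab : 'I_m -> L,
     mostly (robust_const * D) (fun x => [forall j, g j x == lab j])) \/
  (exists (i : 'I_n) (gam : 'I_m -> L),
     mostly (robust_const * D) (fun x => [forall j, g j x == gam ((x i)^-1 j)%g])).
Proof.
move=> small.
pose Q j := [forall j2, mostly C (fun x => g j x == g j2 (shift (swap j j2) x))].
have [/existsP [j /forallP Qj]|/existsPn nQ] := boolP [exists j, Q j]; [right|left].
  have [th thP] := flips_lower_bound Qj small.
  have [i iP] := pivotal_voter thP; exists i.
  have [gam gamP] := label_of_rank iP; exists gam.
  (* The swap carries the rule found for [j] over to [j2]. *)
  have H j2 : mostly (C + #|{: 'S_m}| * (18 * (4 * m * m) * C + D))
      (fun x => g j2 x == gam ((x i)^-1 j2)%g).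
    have := mostly_shift (swap j j2) (mostly_and (Qj j2) gamP).
    move/mostlyW; apply=> // x; rewrite shift_swapK => /andP [/eqP <- /eqP ->].
    by rewrite !ffunE invMg permM tpermV tpermL.
  apply: mostlyW (mostly_all H) _ _ => //.
  rewrite sum_nat_const card_ord /robust_const /C; apply: eq_leq.
  by move: #|_| (D) => S d; clear; lia.
have constP j : exists l, mostly C (fun x => g j x == l).
  by case: (const_or_swap j) => // h; case/negP: (nQ j); apply/forallP.
have [lab labP] := fin_all_exists constP; exists lab.
apply: mostlyW (mostly_all labP) _ _ => //.
rewrite sum_nat_const card_ord /robust_const /C.
by move: #|_| (D) => S d; clear; nia.
Qed.

End Core.

Lemma perm_of_fibres m (L : eqType) (p q : 'I_m -> L) :
  (forall l, #|[pred a | p a == l]| = #|[pred a | q a == l]|) ->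
  exists s : 'S_m, forall a, q (s a) = p a.
Proof.
move=> pq; have : perm_eq [tuple p a | a < m] [tuple q a | a < m].
  apply/allP => l _ /=; rewrite !count_map; apply/eqP.
  have cE (u : 'I_m -> L) :
      #|[pred a | u a == l]| = count (preim u (pred1 l)) (enum 'I_m).
    by rewrite cardE -size_filter enumT.
  by move: (pq l); rewrite !cE enumT.
case/tuple_permP => s e; exists s => a.
by move: (congr1 (fun t => tnth t a) (val_inj e)); rewrite !tnth_mktuple.
Qed.

(** * Cosets of a fixing subgroup *)

Section FixingSubgroup.
Variables (m : nat) (H : {group 'S_m}) (P : {set {set 'I_m}}).
Hypothesis partP : partition P [set: 'I_m].
Hypothesis P_gt1 : 2 <= #|P|.
Hypothesis HE : (H : {set 'S_m}) = [set h : 'S_m | [forall B in P, h @: B == B]].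

Lemma pblock_in a : (pblock P a \in P) * (a \in pblock P a).
Proof.
have aP : a \in cover P by rewrite (cover_partition partP) inE.
by rewrite pblock_mem // mem_pblock.
Qed.

Lemma pblockE B a : B \in P -> a \in B -> pblock P a = B.
Proof. by case/and3P: partP => _ tI _; apply: def_pblock. Qed.

Lemma mem_fixing (h : 'S_m) :
  reflect (forall a, pblock P (h a) = pblock P a) (h \in H).
Proof.
rewrite HE inE; apply: (iffP forall_inP) => [hP a|hP B BP].
  apply: pblockE; rewrite ?pblock_in // -(eqP (hP _ (pblock_in a).1)).
  by rewrite imset_f // pblock_in.
rewrite eqEcard card_imset ?leqnn; last exact: perm_inj.
rewrite andbT; apply/subsetP => _ /imsetP [a aB ->].
by rewrite -(pblockE BP aB) -hP pblock_in.
Qed.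

(* The block of ranks in which all members of the coset [K] put the name [j].  *)
Definition label (K : {set 'S_m}) (j : 'I_m) : {set 'I_m} :=
  pblock P ((repr K)^-1 j)%g.

Lemma label_rcoset y z j : z \in (H :* y)%g ->
  label (H :* y)%g j = pblock P (z^-1 j)%g.
Proof.
move=> zK; have := mem_repr_rcoset H y; rewrite -(rcoset_eqP zK).
rewrite /label => /rcosetP [h hH ->]; rewrite invMg permM.
by apply: (mem_fixing _ _); rewrite groupV.
Qed.

Lemma label_mem K z j : K \in rcosets H [set: 'S_m] -> z \in K ->
  label K j = pblock P (z^-1 j)%g.
Proof. by case/rcosetsP => y _ ->; apply: label_rcoset. Qed.

(** Equal labels mean that [y * y'^-1] keeps each rank in its block. *)
Lemma label_inj K K' : K \in rcosets H [set: 'S_m] ->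
  K' \in rcosets H [set: 'S_m] -> label K =1 label K' -> K = K'.
Proof.
case/rcosetsP => y _ -> /rcosetsP [y' _ ->] e; apply/rcoset_eqP/rcosetP.
exists (y * y'^-1)%g; last by rewrite mulgKV.
apply/mem_fixing => a; rewrite permM.
have := e (y a); rewrite (label_rcoset _ (rcoset_refl H y)).
by rewrite (label_rcoset _ (rcoset_refl H y')) permK => ->.
Qed.

Lemma card_label_fibre K B :
  #|[pred j | label K j == B]| = #|[pred a | pblock P a == B]|.
Proof.
rewrite -[RHS](card_image (@perm_inj _ (repr K))) /label; apply: eq_card => j.
rewrite !inE; apply/idP/imageP => [h|[a + ->]]; last by rewrite inE permK.
by exists ((repr K)^-1 j)%g; rewrite ?inE // permKV.
Qed.

Lemma card_fibre_lt B : #|[pred a | pblock P a == B]| < m.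
Proof.
suff [a na] : exists a, pblock P a != B.
  rewrite -[X in _ < X]card_ord -(cardC [pred a | pblock P a == B]).
  by rewrite -[X in X < _]addn0 ltn_add2l; apply/card_gt0P; exists a; rewrite !inE.
have [B' B'P nB] : exists2 B', B' \in P & B' != B.
  have : 0 < #|P :\ B| by move: P_gt1; rewrite (cardsD1 B); case: (B \in P) => // /ltnW.
  by case/card_gt0P => B'; rewrite !inE => /andP []; exists B'.
have [a aB'] : exists a, a \in B'.
  by apply/set0Pn; apply: contraTneq B'P => ->; case/and3P: partP.
by exists a; rewrite (pblockE B'P aB').
Qed.

Lemma label_jprofile (R : realType) K K' j :
    K \in rcosets H [set: 'S_m] -> K' \in rcosets H [set: 'S_m] ->
    mult_vec R (jprofile K j) = mult_vec R (jprofile K' j) ->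
  label K j = label K' j.
Proof.
move=> hK hK' e; have /rcosetsP [y _ yE] := hK.
have yK : y \in K by rewrite yE rcoset_refl.
have : (y^-1 j)%g \in jprofile K' j.
  move/rowP: e => /(_ (y^-1 j)%g); rewrite !mxE => /eqP; rewrite eqr_nat.
  rewrite -!has_pred1 !has_count => /eqP <-; rewrite -has_count has_pred1.
  by apply/imageP; exists y.
case/imageP => z zK' e'; rewrite (label_mem _ hK yK) (label_mem _ hK' zK').
by rewrite e'.
Qed.

(** * From labels back to cosets *)

Section Aggregator.
Variables (n : nat) (f : social_aggregator n H).
Hypothesis m_gt2 : 2 < m.

Definition flabel j (x : profile m n) := label (val (f x)) j.

Definition total_violations : nat := \sum_j \sum_i violations flabel j i.

(** The second term secures the smallness needed for the dichotomy whenever the claimed bound is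
    below the number of profiles; otherwise any constant works. *)
Definition aggregator_const : nat := robust_const m + 4 * m * (m + 3).

Lemma robust_aggregator : exists h : social_aggregator n H,
  (is_constant h \/ is_dictatorial h) /\
  mostly (aggregator_const * total_violations) (fun x => val (f x) == val (h x)).
Proof.
set V := total_violations.
have [le_N|gt_N] := leqP #|{: profile m n}| (aggregator_const * V).
  exists (fun _ => f [ffun=> 1%g]); split; first by left; exists (f [ffun=> 1%g]).
  by apply: leq_trans le_N; apply: max_card.
have small : 2 * m * (2 * (m + 3) * V) <= #|{: profile m n}|.
  by apply: leq_trans (ltnW gt_N); rewrite /aggregator_const; lia.
have lt_N : robust_const m * V < #|{: profile m n}|.
  by apply: leq_ltn_trans gt_N; rewrite /aggregator_const; lia.
have le_const : robust_const m * V <= aggregator_const * V.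
  by rewrite leq_mul2r leq_addr orbT.
have [[lab labP]|[i [gam gamP]]] := robust_dichotomy m_gt2
    (fun x => card_label_fibre (val (f x))) card_fibre_lt small.
  have [x0 /forallP x0P] := mostly_ex labP lt_N.
  exists (fun _ => f x0); split; first by left; exists (f x0).
  apply: mostlyW labP _ le_const => x /forallP xP; apply/eqP.
  apply: label_inj (valP _) (valP _) _ => j.
  exact: etrans (eqP (xP j)) (esym (eqP (x0P j))).
have [x0 /forallP x0P] := mostly_ex gamP lt_N.
(* One good profile [x0] shows that the fibres of [gam] have the sizes of the blocks. *)
have [y yP] : exists y : 'S_m, forall a, gam (y a) = pblock P a.
  apply: perm_of_fibres => B; rewrite -(card_label_fibre (val (f x0))).
  rewrite -(card_image (@perm_inj _ (x0 i)^-1%g)); apply: eq_card => a.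
  rewrite !inE; apply/imageP/idP => [[j + ->]|gB].
    by rewrite inE; have /eqP <- := x0P j.
  exists (x0 i a); rewrite ?permK // inE.
  by have /eqP := x0P (x0 i a); rewrite /flabel permK => ->.
have cosetP z : (H :* z)%g \in rcosets H [set: 'S_m] by apply/rcosetsP; exists z.
pose h x : coset_space H :=
  exist (fun K => K \in rcosets H [set: 'S_m]) _ (cosetP (y * (x : profile m n) i)%g).
exists h; split.
  by right; exists i, y.
apply: mostlyW gamP _ le_const => x /forallP xP; apply/eqP.
apply: label_inj (valP _) (cosetP _) _ => j.
apply: etrans (eqP (xP j)) _; rewrite (label_rcoset _ (rcoset_refl H _)).
by rewrite -yP invMg permM permKV.
Qed.

End Aggregator.
End FixingSubgroup.

(** * Comparing counts with norms and expectations *)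

Section RealBounds.
Local Open Scope ring_scope.
Variable R : realType.

Lemma frobenius_sqr p q (A : 'M[R]_(p, q)) :
  frobenius A ^+ 2 = \sum_a \sum_b A a b ^+ 2.
Proof. by rewrite sqr_sqrtr //; do 2!apply: sumr_ge0 => ? _; rewrite sqr_ge0. Qed.

Variables (m : nat) (H : {group 'S_m}) (P : {set {set 'I_m}}).
Hypothesis partP : partition P [set: 'I_m].
Hypothesis HE : (H : {set 'S_m}) = [set h : 'S_m | [forall B in P, h @: B == B]].

Lemma Pbar_itv (K : coset_space H) a b : 0 <= Pbar R K a b <= 1.
Proof.
have H_gt0 : 0 < #|H|%:R :> R by rewrite ltr0n cardG_gt0.
have cardK : #|val K| = #|H|.
  by have /rcosetsP [y _ ->] := valP K; rewrite card_rcoset.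
rewrite !mxE summxE mulrC; apply/andP; split.
  by rewrite divr_ge0 ?(ltW H_gt0) // sumr_ge0 // => z _; rewrite !mxE ler0n.
rewrite ler_pdivrMr // mul1r -cardK -sum1_card natr_sum; apply: ler_sum => z _.
by rewrite !mxE; case: (_ == _); rewrite ?ler01.
Qed.

Lemma frobenius_Pbar_le (K K' : coset_space H) :
  frobenius (Pbar R K - Pbar R K') ^+ 2 <= (val K != val K')%:R * m%:R ^+ 2.
Proof.
have [e|_] := eqVneq; rewrite frobenius_sqr.
  rewrite mul0r /Pbar e subrr big1 // => a _; rewrite big1 // => b _.
  by rewrite mxE expr0n.
apply: le_trans (_ : \sum_(a < m) \sum_(b < m) 1 <= _); last first.
  by rewrite !sumr_const card_ord -mulrnA natrM mul1r expr2.
apply: ler_sum => a _; apply: ler_sum => b _; rewrite mxE [X in _ + X]mxE.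
move: (Pbar_itv K a b) (Pbar_itv K' a b).
move: (Pbar R K a b) (Pbar R K' a b) => u v; nra.
Qed.

(** Different labels force different multiplicity vectors, and integer entries that differ do so by
    at least 1. *)
Lemma frobenius_jprofile_ge K K' j : K \in rcosets H [set: 'S_m] ->
    K' \in rcosets H [set: 'S_m] ->
  (label P K j != label P K' j)%:R <= #|H|%:R ^+ 2 *
    frobenius (#|H|%:R^-1 *:
      (mult_vec R (jprofile K j) - mult_vec R (jprofile K' j))) ^+ 2.
Proof.
move=> hK hK'; have [_|ne] := eqVneq; first by rewrite mulr_ge0 ?sqr_ge0.
have H_neq0 : #|H|%:R != 0 :> R by rewrite pnatr_eq0 -lt0n cardG_gt0.
rewrite frobenius_sqr big_ord1 mulr_sumr.
have [a na] : exists a, count_mem a (jprofile K j) != count_mem a (jprofile K' j).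
  apply/existsP; apply: contraNT ne => /existsPn e; apply/eqP.
  apply: (@label_jprofile _ _ _ partP HE R) => //.
  by apply/rowP => a; rewrite !mxE; move: (e a); rewrite negbK => /eqP ->.
rewrite (bigD1 a) //= ler_wpDr //.
  by apply: sumr_ge0 => b _; rewrite mulr_ge0 ?sqr_ge0.
rewrite !mxE exprMn exprVn mulVKf ?expf_neq0 //.
rewrite -(real_normK (num_real _)) exprn_ege1 //; move: na; rewrite neq_ltn.
by case/orP => lt; [rewrite distrC|]; rewrite -natrB ?(ltnW lt) // normr_nat ler1n subn_gt0.
Qed.

Variables (n : nat) (f : social_aggregator n H).

Lemma violations_le_IR : (total_violations P f)%:R <=
  #|{: profile m n}|%:R * #|{: 'S_m}|%:R * #|H|%:R ^+ 2 * IR R f.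
Proof.
rewrite /total_violations exchange_big natr_sum /IR mulr_sumr.
apply: ler_sum => i _; rewrite natr_sum mulr_sumr; apply: ler_sum => j _.
have NS_neq0 : #|{: profile m n}|%:R * #|{: 'S_m}|%:R != 0 :> R.
  rewrite mulf_neq0 // pnatr_eq0 -lt0n; apply/card_gt0P;
    by [exists [ffun=> 1%g]|exists 1%g].
rewrite /expect card_prod natrM [leRHS]mulrC -[leRHS]mulrA mulKf // mulrC.
rewrite mulr_sumr /violations -[X in X%:R <= _]sum1_card natr_sum big_mkcond.
apply: ler_sum => -[x y] _; rewrite inE /=.
case: (_ == _) => /=; last by rewrite mul0r mulr0.
rewrite mul1r; apply: le_trans (frobenius_jprofile_ge j (valP (f x))
  (valP (f (replace_vote x i y)))).
by rewrite /flabel; case: (_ == _).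
Qed.

Lemma expect_Pbar_le (h : social_aggregator n H) c :
    mostly c (fun x => val (f x) == val (h x)) ->
  expect (fun x : profile m n => frobenius (Pbar R (f x) - Pbar R (h x)) ^+ 2)
    <= m%:R ^+ 2 * (c%:R / #|{: profile m n}|%:R).
Proof.
move=> hc; rewrite /expect mulrA ler_wpM2r ?invr_ge0 //.
apply: le_trans (_ : \sum_x (val (f x) != val (h x))%:R * m%:R ^+ 2 <= _).
  by apply: ler_sum => x _; apply: frobenius_Pbar_le.
rewrite -mulr_suml mulrC ler_wpM2l ?sqr_ge0 // -natr_sum ler_nat.
apply: leq_trans hc; rewrite -sum1_card [leqRHS]big_mkcond.
by apply: leq_sum => x _; rewrite inE; case: (_ == _).
Qed.

End RealBounds.

Local Open Scope ring_scope.

Theorem theorem3p10 (R : realType) :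
  exists k : nat,
  forall (m : nat) (H : {group 'S_m}), (3 <= m)%N -> fixing H ->
  exists c : R,
  forall (n : nat) (eps : R) (f : social_aggregator n H),
    (1 <= n)%N -> 0 <= eps -> IR R f <= eps ->
  exists h : social_aggregator n H,
    (is_constant h \/ is_dictatorial h) /\
    expect (fun x : profile m n => frobenius (Pbar R (f x) - Pbar R (h x)) ^+ 2)
      <= c * m%:R ^+ k * eps.
Proof.
(* The exponent 2 comes from the [m ^ 2] matrix entries; the other factors depend on [H] and [m]
   only and go into [c]. *)
exists 2%N => m H m_gt2 [P [partP P_gt1 HE]].
exists ((aggregator_const m)%:R * (#|{: 'S_m}|%:R * #|H|%:R ^+ 2)).
move=> n eps f _ _ IR_le.
have [h [hP h_mostly]] := robust_aggregator partP P_gt1 HE f m_gt2.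
exists h; split=> //; apply: le_trans (expect_Pbar_le R h_mostly) _.
rewrite [leRHS]mulrAC [leRHS]mulrC ler_wpM2l ?sqr_ge0 //.
have N_gt0 : 0 < #|{: profile m n}|%:R :> R.
  by rewrite ltr0n; apply/card_gt0P; exists [ffun=> 1%g].
rewrite ler_pdivrMr // natrM -mulrA -[leRHS]mulrA ler_wpM2l //.
apply: le_trans (violations_le_IR R partP HE f) _.
rewrite mulrA [leRHS]mulrC !mulrA ler_wpM2l //.
by rewrite !mulr_ge0 ?sqr_ge0.
Qed.
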